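(* For all positive integers $n$ and $k$, the map $\mathrm{prh}_k$ is injective on the set of partitions of $n$.
   Context: A partition $\lambda=(\lambda_1,\dots,\lambda_\ell)$ of $n$ is a nonincreasing sequence of positive integers summing to $n$; $\ell$ is its length. For a positive integer $k$, $\mathrm{prh}_k(\lambda)$ is the partition whose parts (with multiplicity) are the summands of the complete homogeneous symmetric polynomial $h_k(\lambda_1,\dots,\lambda_\ell)=\sum_{1\le i_1\le\cdots\le i_k\le \ell}\lambda_{i_1}\cdots\lambda_{i_k}$, i.e. the multiset of all products $\lambda_{i_1}\cdots\lambda_{i_k}$ over weakly increasing index sequences $1\le i_1\le\cdots\le i_k\le \ell$, sorted in nonincreasing order. *)

(* Defs.v *)
From mathcomp Require Import all_boot.

Set Implicit Arguments.
Unset Strict Implicit.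
Unset Printing Implicit Defensive.

Definition intpart : pred (seq nat) :=
  [pred la | sorted geq la & all (ltn 0) la].

Definition intpart_of (n : nat) : pred (seq nat) :=
  [pred la | intpart la & sumn la == n].

Definition weakly_increasing (k l : nat) : {set k.-tuple 'I_l} :=
  [set t : k.-tuple 'I_l | sorted leq (map val t)].

(* Indices run over 0, ..., size la - 1 rather than 1, ..., size la.  The image
   is a list with one entry per index tuple, so equal products are repeated. *)
Definition prh (k : nat) (la : seq nat) : seq nat :=
  sort geq [seq \prod_(i <- t) tnth (in_tuple la) i
           | t : k.-tuple 'I_(size la) in weakly_increasing k (size la)].

Lemma intpart_prh k la : intpart la -> intpart (prh k la).
Proof.
move=> /andP[_ /allP la_gt0]; apply/andP; split.
  by apply: sort_sorted => m n; apply: leq_total.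
rewrite all_sort; apply/allP => _ /imageP[t _ ->].
by apply: prodn_gt0 => i; apply/la_gt0/mem_tnth.
Qed.

(* Main.v *)
Require Import Defs.
From mathcomp Require Import all_boot.

(** Let [la] and [mu] be distinct partitions.  Pad both with zeros, let [j] be
the first position where they differ, and say that [la] has the larger entry
[a] there.  Let [c] be the first, hence largest, entry of [la].  The two lists
of products are told apart by the number of their entries that are at least
[T = a * c ^ (k - 1)].

In [mu], no entry exceeds [c] and the entries from position [j] on are less
than [a], so a product which uses a position at or beyond [j] is less than [T].
Thus the products of [mu] that reach [T] only involve positions before [j],
where [la] and [mu] agree: each of them occurs in [la] as well, at the same
indices.  But [la] has one more, namely [T] itself, obtained from the index
sequence [0, ..., 0, j].  Hence [la] has strictly more products reaching [T]
([count_prh_ltn]).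

A position [j] exists even when one
list is a prefix of the other, because the entries of a partition are positive
and so differ from the padding ([intpart_eq_nth]). *)

(** The default [0] makes this hold past the end of the list too, so that lists
of different lengths can be compared entry by entry. *)
Lemma sorted_geq_nth (s : seq nat) i j :
  sorted geq s -> i <= j -> nth 0 s j <= nth 0 s i.
Proof.
move=> s_sorted le_ij; case: (ltnP j (size s)) => [j_lt|le_j]; last by rewrite nth_default.
have geq_trans : transitive geq by move=> y x z /= yx zy; apply: leq_trans yx.
by apply: (sorted_leq_nth geq_trans leqnn) => //; apply: leq_ltn_trans j_lt.
Qed.

Lemma intpart_nth_gt0 la i : intpart la -> (0 < nth 0 la i) = (i < size la).
Proof.
move=> /andP[_ /allP la_gt0]; case: (ltnP i) => [i_lt|le_i]; last by rewrite nth_default.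
exact/la_gt0/mem_nth.
Qed.

Lemma intpart_eq_nth la mu :
  intpart la -> intpart mu -> nth 0 la =1 nth 0 mu -> la = mu.
Proof.
move=> la_part mu_part eq_nth; apply: (@eq_from_nth _ 0) => //.
have lt_size i : (i < size la) = (i < size mu).
  by rewrite -!intpart_nth_gt0 // eq_nth.
by apply/eqP; rewrite eqn_leq leqNgt lt_size ltnn leqNgt -lt_size ltnn.
Qed.

Lemma prodn_seq_leq_exp (I : Type) (r : seq I) (F : I -> nat) c :
  (forall i, F i <= c) -> \prod_(i <- r) F i <= c ^ size r.
Proof.
move=> F_le; elim: r => [|i r IHr]; first by rewrite big_nil.
by rewrite big_cons expnS leq_mul.
Qed.

(** Replacing the entries of [la] by values of [nth 0 la] on natural numbers
frees the products from the index type ['I_(size la)], which depends on [la]. *)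
Lemma count_prh_geq k la T :
  count (leq T) (prh k la) =
  #|[set t in weakly_increasing k (size la)
      | T <= \prod_(i <- map val t) nth 0 la i]|.
Proof.
rewrite /prh (permP (permEl (perm_sort _ _))) count_map -size_filter.
rewrite cardE; apply/perm_size/uniq_perm.
- by rewrite filter_uniq ?enum_uniq.
- exact: enum_uniq.
move=> t; rewrite mem_filter !mem_enum !inE andbC big_map /=.
by congr (_ && (_ <= _)); apply: eq_bigr => i _; rewrite (tnth_nth 0).
Qed.

(** The index sequences of [mu] whose product reaches [T] stay below [j], so
they are index sequences of [la] with the same product; the sequence
[0, ..., 0, j] of [la], whose product is exactly [T], is not among them. *)
Lemma count_prh_ltn k la mu j (T := nth 0 la j * nth 0 la 0 ^ k) :
    sorted geq la -> sorted geq mu ->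
    {in gtn j, nth 0 la =1 nth 0 mu} -> nth 0 mu j < nth 0 la j ->
  count (leq T) (prh k.+1 mu) < count (leq T) (prh k.+1 la).
Proof.
move=> la_sorted mu_sorted eq_below mu_lt_la.
have j_lt : j < size la.
  by rewrite ltnNge; apply: contraL mu_lt_la => le_j; rewrite [X in _ < X]nth_default.
have la0_gt0 : 0 < nth 0 la 0.
  apply: leq_trans (sorted_geq_nth _ _ _ la_sorted (leq0n j)).
  exact: leq_ltn_trans mu_lt_la.
have mu_le i : nth 0 mu i <= nth 0 la 0.
  apply: leq_trans (sorted_geq_nth _ _ _ mu_sorted (leq0n i)) _.
  case: (posnP j) => [j0|j_gt0]; last by rewrite eq_below.
  by rewrite -[X in nth 0 mu X]j0 -[X in nth 0 la X]j0 ltnW.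
have below (r : seq nat) : size r = k.+1 ->
    T <= \prod_(i <- r) nth 0 mu i -> {in r, forall i, i < j}.
  move=> size_r T_le i r_i; rewrite ltnNge; apply: contraL T_le => j_le.
  rewrite -ltnNge (big_rem i) //=.
  have le_exp : \prod_(m <- rem i r) nth 0 mu m <= nth 0 la 0 ^ k.
    have -> : k = size (rem i r) by rewrite size_rem // size_r.
    exact: prodn_seq_leq_exp.
  apply: leq_ltn_trans (leq_mul (leqnn _) le_exp) _.
  rewrite ltn_pmul2r ?expn_gt0 ?la0_gt0 //.
  exact: leq_ltn_trans (sorted_geq_nth _ _ _ mu_sorted j_le) mu_lt_la.
pose i0 := Ordinal (leq_ltn_trans (leq0n j) j_lt).
pose reindex (t : k.+1.-tuple 'I_(size mu)) : k.+1.-tuple 'I_(size la) :=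
  [tuple of map (insubd i0 \o val) t].
pose top : k.+1.-tuple 'I_(size la) :=
  [tuple of rcons (nseq k i0) (Ordinal j_lt)].
rewrite !count_prh_geq; set A := [set t in _ | _]; set B := [set t in _ | _].
have A_below t : t \in A -> {in map val t, forall i, i < j}.
  by rewrite inE => /andP[_]; apply: below; rewrite size_map size_tuple.
have reindexK t : t \in A -> map val (reindex t) = map val t.
  move=> tA; rewrite -map_comp; apply/eq_in_map => i t_i /=.
  rewrite val_insubd (ltn_trans _ j_lt) //.
  by apply: (A_below t tA); apply: map_f.
have reindex_inj : {in A &, injective reindex}.
  move=> t u tA uA eq_tu; apply/val_inj/(inj_map val_inj).
  by rewrite -reindexK // eq_tu reindexK.
rewrite -(card_in_imset reindex_inj); apply/proper_card/properP; split.
  apply/subsetP => _ /imsetP[t tA ->]; rewrite !inE reindexK //.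
  have := tA; rewrite !inE => /andP[-> T_le] /=.
  rewrite (eq_big_seq (nth 0 mu)) // => i t_i.
  by apply/eq_below/(A_below t tA).
exists top.
  rewrite !inE map_rcons map_nseq; apply/andP; split.
    by case: (k) => //= k'; elim: k' => //= k' ->.
  rewrite -cats1 big_cat big_nseq big_seq1 /= mulnC.
  by rewrite iter_muln_1.
(* A reindexed sequence stays below [j], whereas [top] ends with [j]. *)
apply/imsetP => -[t tA eq_top].
have /(A_below t tA): j \in map val t.
  by rewrite -reindexK // -eq_top map_rcons mem_rcons inE eqxx.
by rewrite ltnn.
Qed.

Theorem theorem1p5 (n k : nat) (n_gt0 : 0 < n) (k_gt0 : 0 < k) :
  {in intpart_of n &, injective (prh k)}.
Proof.
case: k k_gt0 => // k _ la mu /andP[la_part _] /andP[mu_part _] eq_prh.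
have [la_sorted _] := andP la_part; have [mu_sorted _] := andP mu_part.
apply: intpart_eq_nth => // i; apply/eqP.
elim/ltn_ind: i => j eq_below; apply/negPn/negP.
have {}eq_below : {in gtn j, nth 0 la =1 nth 0 mu}.
  by move=> i /eq_below/eqP.
rewrite neq_ltn => /orP[la_lt|mu_lt].
  have eq_below' : {in gtn j, nth 0 mu =1 nth 0 la}.
    by move=> i /eq_below->.
  have := count_prh_ltn k mu la j mu_sorted la_sorted eq_below' la_lt.
  by rewrite eq_prh ltnn.
have := count_prh_ltn k la mu j la_sorted mu_sorted eq_below mu_lt.
by rewrite eq_prh ltnn.
Qed.
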